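(* Let $\mathbb{K}$ be an algebraically closed field, let $A$ be a $\mathbb{K}$-algebra which is a domain, let $\alpha$ be a $\mathbb{K}$-automorphism of $A$, let $u\in Z(A)\setminus\mathbb{K}$ and let $R=R(A,\alpha,u-\alpha(u),1)$ be the corresponding conformal ambiskew polynomial ring, with Casimir element $z=xy-u$. Suppose that $A[y^{\pm 1};\alpha]$ is simple and $Z(A[y^{\pm 1};\alpha])=\mathbb{K}$. Let $\lambda\in\mathbb{K}$ be such that $(u+\lambda)A+\alpha^m(u+\lambda)A\neq A$ for some $m\geq 1$. If the ideal $(u+\lambda)A+\alpha^m(u+\lambda)A$ is maximal and $(u+\lambda)A+\alpha^n(u+\lambda)A=A$ for all positive integers $n\neq m$, then $R/(z-\lambda)R$ has a unique non-zero prime ideal.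
   Context: Rings are associative with $1$; $Z(\cdot)$ denotes the centre. For a $\mathbb{K}$-algebra $A$, a $\mathbb{K}$-automorphism $\alpha$ of $A$ and a central element $v\in A$, the ambiskew polynomial algebra $R(A,\alpha,v,1)$ is the iterated skew polynomial ring $A[y;\alpha][x;\beta,\delta]$, where $\beta=\alpha^{-1}$ on $A$, $\beta(y)=y$, and $\delta$ is the $\beta$-derivation of $A[y;\alpha]$ with $\delta(A)=0$ and $\delta(y)=v$. Thus $ya=\alpha(a)y$ and $xa=\alpha^{-1}(a)x$ for all $a\in A$, and $xy=yx+v$. When $v=u-\alpha(u)$ with $u$ central in $A$, the ring is called conformal and the Casimir element $z=xy-u$ is central in $R$. The ring $A[y^{\pm 1};\alpha]$ is the skew Laurent polynomial ring with $ya=\alpha(a)y$. *)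

(* Defs.v *)
From HB Require Import structures.
From mathcomp Require Import all_boot all_order all_algebra.
From mathcomp Require Import boolp classical_sets.

Set Implicit Arguments.
Unset Strict Implicit.
Unset Printing Implicit Defensive.

Import GRing.Theory.
Local Open Scope classical_set_scope.
Local Open Scope ring_scope.

(* The ideals in algebra/ring_quotient are boolean predicates on commutative
   rings, so two-sided ideals of an arbitrary ring are introduced here as
   classical sets. *)

Section Ideals.
Variable R : pzRingType.
Implicit Types (I J P : set R) (a b c : R).

Definition ring_center : set R := [set c | forall a, GRing.comm c a].

Record two_sided_ideal I : Prop := TwoSidedIdeal {
  ideal_zero : I 0;
  ideal_add : forall a b, I a -> I b -> I (a + b);
  ideal_mull : forall a b, I b -> I (a * b);
  ideal_mulr : forall a b, I a -> I (a * b)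
}.

Definition maximal_ideal I : Prop :=
  [/\ two_sided_ideal I, I <> setT &
      forall J, two_sided_ideal J -> I `<=` J -> J = I \/ J = setT].

(* IJ is the set of finite sums of products of elements of I and of J. *)
Definition ideal_product I J : set R :=
  [set a | exists s : seq (R * R),
     (forall t, t \in s -> I t.1 /\ J t.2) /\ a = \sum_(t <- s) t.1 * t.2].

Definition prime_ideal P : Prop :=
  [/\ two_sided_ideal P, P <> setT &
      forall I J, two_sided_ideal I -> two_sided_ideal J ->
        ideal_product I J `<=` P -> I `<=` P \/ J `<=` P].

Definition simple_ring : Prop :=
  (1 : R) <> 0 /\
  forall I, two_sided_ideal I -> I = [set 0] \/ I = setT.

(* The library's axiom does not exclude the zero ring. *)
Definition is_domain : Prop :=
  (1 : R) <> 0 /\ GRing.integral_domain_axiom R.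

Definition right_multiples c : set R := [set c * a | a in setT].

Definition set_sum I J : set R := [set a + b | a in I & b in J].

End Ideals.

Arguments ring_center R : clear implicits.

(* pi presents T as the quotient ring R/I; this forces I to be a two-sided
   ideal, and T is determined by I up to isomorphism. *)
Definition is_quotient (R T : pzRingType) (I : set R)
    (pi : {rmorphism R -> T}) : Prop :=
  (forall t, exists a, pi a = t) /\ pi @^-1` [set 0] = I.

(* T is free as a left B-module, B acting through iota, with basis (e i)_i. *)
Definition left_basis (B T : pzRingType) (iota : B -> T) (I : eqType)
    (e : I -> T) : Prop :=
  (forall t, exists (r : seq I) (c : I -> B),
     t = \sum_(i <- r) iota (c i) * e i) /\
  (forall (r : seq I) (c : I -> B), uniq r ->
     \sum_(i <- r) iota (c i) * e i = 0 -> forall i, i \in r -> c i = 0).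

Definition skew_derivation (B : pzRingType) (sigma delta : B -> B) : Prop :=
  (forall a b, delta (a + b) = delta a + delta b) /\
  (forall a b, delta (a * b) = sigma a * delta b + delta a * b).

(* T = B[t; sigma, delta], with coefficients written on the left: T is a ring
   containing B via iota, it is a free left B-module on the powers of t, and
   t b = sigma(b) t + delta(b).  Injectivity of iota follows from freeness. *)
Definition is_skew_polynomial_ring (B T : pzRingType) (sigma : B -> B)
    (delta : B -> B) (iota : {rmorphism B -> T}) (t : T) : Prop :=
  [/\ skew_derivation sigma delta,
      left_basis iota (fun n : nat => t ^+ n) &
      forall b, t * iota b = iota (sigma b) * t + iota (delta b)].

(* T = B[t^{+-1}; sigma], for an automorphism sigma. *)
Definition is_skew_laurent_ring (B : pzRingType) (T : unitRingType)
    (sigma : B -> B) (iota : {rmorphism B -> T}) (t : T) : Prop :=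
  [/\ t \is a GRing.unit,
      left_basis iota (fun n : int => t ^ n) &
      forall b, t * iota b = iota (sigma b) * t].

(* R = R(A, alpha, v, 1), with A embedded in R by f: the intermediate ring is
   S = A[y; alpha], with y = y0 in S, and R = S[x; beta, delta].  As alpha is
   onto, beta (i (alpha a)) = i a says that beta restricts to alpha^-1 on A. *)
Definition is_ambiskew_polynomial_ring (K : fieldType) (A R : algType K)
    (alpha : {lrmorphism A -> A}) (v : A)
    (f : {lrmorphism A -> R}) (x y : R) : Prop :=
  exists (S : algType K) (i : {lrmorphism A -> S}) (y0 : S)
         (beta : {rmorphism S -> S}) (delta : S -> S)
         (j : {lrmorphism S -> R}),
    [/\ is_skew_polynomial_ring alpha (fun=> 0) i y0,
        (forall a, beta (i (alpha a)) = i a) /\ beta y0 = y0,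
        (forall a, delta (i a) = 0) /\ delta y0 = i v,
        is_skew_polynomial_ring beta delta j x &
        (forall a, f a = j (i a)) /\ y = j y0].

(* Main.v *)
Require Import Defs.
From HB Require Import structures.
From mathcomp Require Import all_boot all_order all_algebra.
From mathcomp Require Import boolp classical_sets.

(* Put w = u + lambda.  The quotient Q of R is the generalized Weyl algebra
   generated over A by X and Y with X Y = w and Y X = alpha(w).  Simplicity of
   A[y^{+-1}; alpha] forces every non-zero ideal of Q to contain powers of X
   and of Y, and comaximality of w and alpha^n(w) lowers an exponent n <> m by
   one; so a proper non-zero ideal contains X^m and Y^m.  Modulo such an ideal
   e = Y^(m-1) X^(m-1) is a scalar multiple of an idempotent generating the
   unit ideal, and its corner is A/M, M being the given maximal ideal of A.  As
   an ideal is determined by its trace on this full corner, Q has at most one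
   proper non-zero ideal.  One exists: the largest ideal whose elements have
   their degree 0 coefficient in M contains Y^m but not 1. *)

Set Implicit Arguments.
Unset Strict Implicit.
Unset Printing Implicit Defensive.

Import GRing.Theory.
Local Open Scope classical_set_scope.
Local Open Scope ring_scope.

(** * Additive maps out of a free left module *)

Section LeftBasis.
Variables (B T : pzRingType) (iota : {rmorphism B -> T}).
Variables (I : eqType) (e : I -> T).

(** Freeness speaks only of duplicate-free lists of indices; collecting the terms of equal index
    reduces any list to such a one. *)
Lemma sum_collect (V : zmodType) (phi : I -> B -> V) (l : seq (I * B)) :
  (forall i a b, phi i (a + b) = phi i a + phi i b) ->
  \sum_(p <- l) phi p.1 p.2 =
  \sum_(i <- undup (map fst l)) phi i (\sum_(p <- l | p.1 == i) p.2).
Proof.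
move=> phiD.
have phi0 i : phi i 0 = 0 by apply: (addrI (phi i 0)); rewrite -phiD !addr0.
under [RHS]eq_bigr => i _ do rewrite (big_morph (phi i) (phiD i) (phi0 i)).
rewrite (exchange_big_dep predT) //=.
rewrite big_seq [RHS]big_seq; apply: eq_bigr => p pl.
have pr : p.1 \in undup (map fst l) by rewrite mem_undup map_f.
rewrite -big_filter (eq_filter (a2 := pred1 p.1)); last by move=> i /=; rewrite eq_sym.
by rewrite filter_pred1_uniq ?undup_uniq // big_seq1.
Qed.

Hypothesis basis_e : left_basis iota e.

(** Two presentations of one element differ by a relation, whose collected coefficients vanish by
    freeness, so they receive the same value. *)
Lemma linear_extension (V : zmodType) (phi : I -> B -> V) :
  (forall i a b, phi i (a + b) = phi i a + phi i b) ->
  exists F : T -> V, (forall a b, F (a + b) = F a + F b) /\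
    forall i b, F (iota b * e i) = phi i b.
Proof.
move=> phiD; case: basis_e => spanning free.
have phi0 i : phi i 0 = 0 by apply: (addrI (phi i 0)); rewrite -phiD !addr0.
have phiN i b : phi i (- b) = - phi i b.
  by apply: (addrI (phi i b)); rewrite -phiD !subrr phi0.
pose ev (l : seq (I * B)) := \sum_(p <- l) iota p.2 * e p.1.
pose ph (l : seq (I * B)) := \sum_(p <- l) phi p.1 p.2.
have ev0 l : ev l = 0 -> ph l = 0.
  rewrite /ev /ph (@sum_collect _ (fun i b => iota b * e i)); last first.
    by move=> i a b; rewrite rmorphD mulrDl.
  move=> /(free _ _ (undup_uniq _)) c0.
  by rewrite sum_collect // big_seq big1 // => i /c0 ->.
pose neg (l : seq (I * B)) := [seq (p.1, - p.2) | p <- l].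
have evN l : ev (neg l) = - ev l.
  rewrite /ev big_map -sumrN; apply: eq_bigr => p _.
  by rewrite rmorphN mulNr.
have phN l : ph (neg l) = - ph l.
  by rewrite /ph big_map -sumrN; apply: eq_bigr => p _; rewrite phiN.
have evC l1 l2 : ev (l1 ++ l2) = ev l1 + ev l2 by rewrite /ev big_cat.
have phC l1 l2 : ph (l1 ++ l2) = ph l1 + ph l2 by rewrite /ph big_cat.
have inj l1 l2 : ev l1 = ev l2 -> ph l1 = ph l2.
  move=> eq12; apply/subr0_eq; rewrite -phN -phC.
  by apply: ev0; rewrite evC evN eq12 subrr.
have ex_l s : exists l, ev l = s.
  have [r [c ->]] := spanning s.
  by exists [seq (i, c i) | i <- r]; rewrite /ev big_map.
have [L evL] := choice ex_l.
exists (fun s => ph (L s)); split=> [a b|i b].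
  by rewrite -phC; apply: inj; rewrite evC !evL.
transitivity (ph [:: (i, b)]); last by rewrite /ph big_seq1.
by apply: inj; rewrite evL /ev big_seq1.
Qed.

End LeftBasis.

(** * Generalized Weyl algebras and their grading *)

Definition graded_gen (Q : pzRingType) (X Y : Q) (n : int) : Q :=
  match n with Posz k => Y ^+ k | Negz k => X ^+ k.+1 end.

(* The generalized Weyl algebra relations over A; tau is the inverse of sigma. *)
Record gwa (A Q : pzRingType) (sigma tau : A -> A) (w : A)
    (h : {rmorphism A -> Q}) (X Y : Q) : Prop := Gwa {
  gwaK : cancel sigma tau;
  gwaVK : cancel tau sigma;
  gwa0 : sigma 0 = 0;
  gwaY : forall a, Y * h a = h (sigma a) * Y;
  gwaX : forall a, X * h a = h (tau a) * X;
  gwaXY : X * Y = h w;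
  gwaYX : Y * X = h (sigma w)
}.

Definition graded_span (A Q : pzRingType) (h : {rmorphism A -> Q}) (X Y : Q) :=
  forall q, exists l : seq (int * A),
    q = \sum_(p <- l) h p.2 * graded_gen X Y p.1.

Lemma graded_genN (Q : pzRingType) (X Y : Q) n :
  graded_gen Y X n = graded_gen X Y (- n).
Proof. by case: n => [[|k]|k]. Qed.

Lemma graded_span_dual (A Q : pzRingType) (h : {rmorphism A -> Q}) (X Y : Q) :
  graded_span h X Y -> graded_span h Y X.
Proof.
move=> sp q; have [l ->] := sp q; exists [seq (- p.1, p.2) | p <- l].
rewrite big_map; apply: eq_bigr => p _ /=.
by rewrite [in RHS]graded_genN opprK.
Qed.

Lemma graded_ind (A Q : pzRingType) (h : {rmorphism A -> Q}) (X Y : Q) :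
  graded_span h X Y -> forall D : Q -> Prop,
  D 0 -> (forall a b, D a -> D b -> D (a + b)) ->
  (forall a n, D (h a * graded_gen X Y n)) -> forall q, D q.
Proof. by move=> sp D D0 DD Dg q; have [l ->] := sp q; apply: big_ind. Qed.

Section Gwa.
Variables (A Q : pzRingType) (sigma tau : A -> A) (w : A).
Variables (h : {rmorphism A -> Q}) (X Y : Q).
Hypothesis G : gwa sigma tau w h X Y.

(** Exchanging [X] and [Y] inverts the automorphism and turns [w] into [sigma w]; facts about [Y]
    thus transfer to [X]. *)
Lemma gwa_dual : gwa tau sigma (sigma w) h Y X.
Proof.
by case: G => sK tK s0 hY hX hXY hYX; split=> //; rewrite ?sK // -{1}s0 sK.
Qed.

Lemma gwaYn k a : Y ^+ k * h a = h (iter k sigma a) * Y ^+ k.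
Proof.
elim: k a => [|k IH] a; first by rewrite !expr0 mul1r mulr1.
by rewrite exprS -mulrA IH mulrA (gwaY G) -mulrA -exprS iterS.
Qed.

Lemma gwaXn k a : X ^+ k * h a = h (iter k tau a) * X ^+ k.
Proof.
elim: k a => [|k IH] a; first by rewrite !expr0 mul1r mulr1.
by rewrite exprS -mulrA IH mulrA (gwaX G) -mulrA -exprS iterS.
Qed.

(** Homogeneous elements, with [Y] in degree 1 and [X] in degree -1. *)
Definition gdeg (n : int) : set Q :=
  [set q | exists a, q = h a * graded_gen X Y n].

Lemma gdeg_mul_h a n q : gdeg n q -> gdeg n (h a * q).
Proof. by case=> b ->; exists (a * b); rewrite rmorphM mulrA. Qed.

(** In negative degree the new [Y] meets an [X], and Y X = sigma(w) is absorbed into the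
    coefficient. *)
Lemma gdeg_mul_Y n q : gdeg n q -> gdeg (n + 1) (Y * q).
Proof.
case=> a ->; rewrite mulrA (gwaY G) -mulrA; apply: gdeg_mul_h.
case: n => [k|[|k]] /=.
- by exists 1; rewrite rmorph1 mul1r -PoszD addn1 -exprS.
- by exists (sigma w); rewrite mulr1 -(gwaYX G).
- exists (sigma w); rewrite exprS mulrA (gwaYX G).
  by rewrite (_ : Negz k.+1 + 1 = Negz k) // !NegzE -addn1 PoszD opprD addrNK.
Qed.

End Gwa.

Lemma gdegN (A Q : pzRingType) (h : {rmorphism A -> Q}) (X Y : Q) n :
  gdeg h Y X n = gdeg h X Y (- n).
Proof. by rewrite /gdeg graded_genN. Qed.

Section GwaDegree.
Variables (A Q : pzRingType) (sigma tau : A -> A) (w : A).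
Variables (h : {rmorphism A -> Q}) (X Y : Q).
Hypothesis G : gwa sigma tau w h X Y.
Local Notation gd := (gdeg h X Y).

Lemma gdeg_mul_X n q : gd n q -> gd (n - 1) (X * q).
Proof.
rewrite -[n]opprK -gdegN => /(gdeg_mul_Y (gwa_dual G)).
by rewrite gdegN opprD.
Qed.

Lemma gdeg_mul n k p q : gd n p -> gd k q -> gd (n + k) (p * q).
Proof.
case=> a -> gq; rewrite -mulrA; apply: gdeg_mul_h.
case: n => j /=.
- elim: j => [|j IH]; first by rewrite expr0 mul1r add0r.
  rewrite exprS -mulrA (_ : _ + k = (Posz j + k) + 1); first exact: (gdeg_mul_Y G).
  by rewrite -addn1 PoszD addrAC.
- elim: j => [|j IH]; first by rewrite expr1 addrC; apply: gdeg_mul_X.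
  rewrite exprS -mulrA (_ : _ + k = (Negz j + k) - 1); first exact: gdeg_mul_X.
  by rewrite !NegzE -addn1 PoszD opprD addrAC.
Qed.

End GwaDegree.

(** * Comparison with the skew Laurent ring *)

Section Localization.
Variables (A Q : pzRingType) (L : unitRingType) (sigma tau : A -> A) (w : A).
Variables (h : {rmorphism A -> Q}) (X Y : Q) (g : {rmorphism A -> L}) (t : L).
Hypothesis G : gwa sigma tau w h X Y.
Hypothesis Q_span : graded_span h X Y.
Hypothesis t_unit : t \is a GRing.unit.
Hypothesis t_basis : left_basis g (fun n : int => t ^ n).
Hypothesis t_comm : forall a, t * g a = g (sigma a) * t.

(* poly_pair l q: l and q are the values at t and at Y of the same polynomial
   with coefficients in A. *)
Inductive poly_pair : L -> Q -> Prop :=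
| PolyPair0 : poly_pair 0 0
| PolyPairD l q l' q' :
    poly_pair l q -> poly_pair l' q' -> poly_pair (l + l') (q + q')
| PolyPairM a k : poly_pair (g a * t ^+ k) (h a * Y ^+ k).

Lemma laurentXn k a : t ^+ k * g a = g (iter k sigma a) * t ^+ k.
Proof.
elim: k a => [|k IH] a; first by rewrite !expr0 mul1r mulr1.
by rewrite exprS -mulrA IH mulrA t_comm -mulrA -exprS iterS.
Qed.

Lemma poly_pair_map (F : L -> L) (E : Q -> Q) :
  {morph F : a b / a + b} -> {morph E : a b / a + b} ->
  (forall a k, poly_pair (F (g a * t ^+ k)) (E (h a * Y ^+ k))) ->
  forall l q, poly_pair l q -> poly_pair (F l) (E q).
Proof.
move=> FD ED FE l q; elim=> [|l1 q1 l2 q2 _ IH1 _ IH2|//].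
  have F0 : F 0 = 0 by apply: (addrI (F 0)); rewrite -FD !addr0.
  have E0 : E 0 = 0 by apply: (addrI (E 0)); rewrite -ED !addr0.
  by rewrite F0 E0; constructor.
by rewrite FD ED; constructor.
Qed.

Lemma poly_pair_hl a l q : poly_pair l q -> poly_pair (g a * l) (h a * q).
Proof.
apply: poly_pair_map => [b c|b c|b k]; rewrite ?mulrDr // !mulrA -!rmorphM.
exact: PolyPairM.
Qed.

Lemma poly_pair_hr a l q : poly_pair l q -> poly_pair (l * g a) (q * h a).
Proof.
apply: (poly_pair_map (F := fun l => l * g a) (E := fun q => q * h a)).
- by move=> b c; rewrite mulrDl.
- by move=> b c; rewrite mulrDl.
move=> b k; rewrite -!mulrA laurentXn (gwaYn G) !mulrA -!rmorphM.
exact: PolyPairM.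
Qed.

Lemma poly_pair_Yl n l q : poly_pair l q -> poly_pair (t ^+ n * l) (Y ^+ n * q).
Proof.
apply: poly_pair_map => [b c|b c|b k]; rewrite ?mulrDr // !mulrA.
by rewrite laurentXn (gwaYn G) -!mulrA -!exprD; apply: PolyPairM.
Qed.

Lemma poly_pair_Yr n l q : poly_pair l q -> poly_pair (l * t ^+ n) (q * Y ^+ n).
Proof.
apply: (poly_pair_map (F := fun l => l * t ^+ n) (E := fun q => q * Y ^+ n)).
- by move=> b c; rewrite mulrDl.
- by move=> b c; rewrite mulrDl.
by move=> b k; rewrite -!mulrA -!exprD; apply: PolyPairM.
Qed.

(** Freeness of the powers of [t] gives an additive map carrying g(a) t^k to h(a) Y^k for k >= 0; on
    negative powers it takes the filler value 0. *)
Lemma poly_pair_fun l q q' : poly_pair l q -> poly_pair l q' -> q = q'.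
Proof.
pose phi (n : int) a := if n is Posz k then h a * Y ^+ k else 0.
have [|F [FD Fphi]] := linear_extension t_basis (phi := phi).
  by case=> k a b; rewrite /phi ?addr0 // rmorphD mulrDl.
suff eqF l1 q1 : poly_pair l1 q1 -> F l1 = q1 by move=> /eqF <- /eqF <-.
elim=> [|l2 q2 l3 q3 _ <- _ <-|a k]; last exact: (Fphi (Posz k)).
  by apply: (addrI (F 0)); rewrite -FD !addr0.
exact: FD.
Qed.

Lemma laurent_ind (D : L -> Prop) :
  D 0 -> (forall a b, D a -> D b -> D (a + b)) ->
  (forall a n, D (g a * t ^ n)) -> forall l, D l.
Proof.
move=> D0 DD Dg l; case: t_basis => sp _; have [r [c ->]] := sp l.
exact: big_ind.
Qed.


Hypothesis A_domain : is_domain A.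
Hypothesis w_neq0 : w <> 0.

(** The next scalar is tau(c) w; here tau(c) = 0 would give c = sigma(0) = 0. *)
Lemma gwa_XnYn k : exists2 c, c <> 0 & X ^+ k * Y ^+ k = h c.
Proof.
have [one0 dom] := A_domain.
elim: k => [|k [c c0 IH]]; first by exists 1; rewrite ?rmorph1 // !expr0 mulr1.
exists (tau c * w); last first.
  by rewrite exprS exprSr mulrA -(mulrA X) IH (gwaX G) -mulrA (gwaXY G) rmorphM.
move=> /dom /orP [] /eqP // tc0; apply: c0.
by rewrite -(gwaVK G c) tc0 (gwa0 G).
Qed.

(* After multiplication by a large power of Y an element of Q becomes a
   polynomial in Y over A, which we compare with its image in L.  Grouping the
   terms by degree is what makes that image non-zero. *)
Lemma poly_pair_neq0 q : q <> 0 ->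
  exists l N, l <> 0 /\ poly_pair l (q * Y ^+ N).
Proof.
have [one0 dom] := A_domain.
(* [pi n] clears the denominator: it is 1 for n >= 0, and for n = -k it is the scalar X^k Y^k. *)
have /choice [pi piP] : forall n : int, exists c, c <> 0 /\
    exists N, forall k a, poly_pair (g (a * c) * t ^ n * t ^+ (N + k))
                (h a * graded_gen X Y n * Y ^+ (N + k)).
  move=> [k|k].
    exists 1; split=> //; exists 0%N => j a.
    by rewrite mulr1 /= -!mulrA -exprnP -!exprD; apply: PolyPairM.
  have [c c0 XY] := gwa_XnYn k.+1; exists c; split=> //; exists k.+1 => j a.
  rewrite NegzE -exprnN !exprD -!mulrA mulKr ?unitrX //= !mulrA -(mulrA (h a)).
  by rewrite XY -rmorphM; apply: PolyPairM.
have /choice [bound boundP] : forall n, exists N, forall k a, (N <= k)%N ->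
   poly_pair (g (a * pi n) * t ^ n * t ^+ k) (h a * graded_gen X Y n * Y ^+ k).
  move=> n; have [_ [N NP]] := piP n; exists N => k a leNk.
  by rewrite -(subnKC leNk).
have [l ->] := Q_span q.
rewrite (@sum_collect _ _ _ (fun n a => h a * graded_gen X Y n)); last first.
  by move=> n a b; rewrite rmorphD mulrDl.
set s := undup _; set c := fun n : int => \sum_(p <- l | p.1 == n) p.2.
move=> q0; pose N := \max_(n <- s) bound n.
exists ((\sum_(n <- s) g (c n * pi n) * t ^ n) * t ^+ N), N; split; last first.
  rewrite !mulr_suml big_seq [X in poly_pair _ X]big_seq.
  elim/big_ind2: _ => [|l1 q1 l2 q2 C1 C2|n ns]; [by constructor|by constructor|].
  by apply: boundP; apply: leq_bigmax_seq.
move=> l0; apply: q0; rewrite big_seq big1 // => n ns.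
have {}l0 : \sum_(n <- s) g (c n * pi n) * t ^ n = 0.
  by apply: (mulIr (unitrX N t_unit)); rewrite mul0r.
case: t_basis => _ /(_ s (fun n => c n * pi n) (undup_uniq _) l0 n ns).
move=> /dom /orP [] /eqP; last by have [] := piP n.
by rewrite -/(c n) => ->; rewrite rmorph0 mul0r.
Qed.

Hypothesis L_simple : simple_ring L.

(* The elements l with t^a l t^b in I for some a, b form an ideal of L. *)
Lemma ideal_has_power I : two_sided_ideal I -> I <> [set 0] ->
  exists d, I (Y ^+ d).
Proof.
move=> [I0 ID IMl IMr] In0; case: L_simple => _ L_ideals.
pose J : set L := [set l | exists a b q,
  poly_pair (t ^+ a * l * t ^+ b) q /\ I q].
have J0 : J 0.
  by exists 0%N, 0%N, 0; rewrite mulr0 mul0r; split=> //; constructor.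
have JD l l' : J l -> J l' -> J (l + l').
  move=> [a [b [q [Cl Iq]]]] [a' [b' [q' [Cl' Iq']]]].
  (* Adding the exponents gives both elements common outer powers of [t]. *)
  exists (a' + a)%N, (b + b')%N, (Y ^+ a' * q * Y ^+ b' + Y ^+ a * q' * Y ^+ b).
  split; last by apply: ID; apply/IMr/IMl.
  rewrite mulrDr mulrDl; apply: PolyPairD.
    rewrite !exprD mulrA; apply/poly_pair_Yr; rewrite -!mulrA.
    by apply: poly_pair_Yl; rewrite mulrA.
  rewrite addnC [(b + b')%N]addnC !exprD !mulrA.
  apply/poly_pair_Yr; rewrite -!mulrA; apply: poly_pair_Yl.
  by rewrite mulrA.
have J_gl a l : J l -> J (g a * l).
  move=> [i [j [q [Cl Iq]]]].
  exists i, j, (h (iter i sigma a) * q); split; last exact: IMl.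
  by rewrite mulrA laurentXn -!mulrA; apply: poly_pair_hl; rewrite mulrA.
have J_gr a l : J l -> J (l * g a).
  move=> [i [j [q [Cl Iq]]]]; exists i, j, (q * h (iter j tau a)).
  split; last exact: IMr.
  have -> : g a = g (iter j sigma (iter j tau a)).
    congr (g _); elim: j {Cl} => // j IH; rewrite iterSr iterS (gwaVK G).
    exact: IH.
  by rewrite -!mulrA -laurentXn !mulrA; apply: poly_pair_hr.
have J_tl n l : J l -> J (t ^ n * l).
  move=> [i [j [q [Cl Iq]]]]; case: n => k.
    exists i, j, (Y ^+ k * q); split; last exact: IMl.
    rewrite mulrA -exprnP -exprD addnC exprD -!mulrA.
    by apply: poly_pair_Yl; rewrite mulrA.
  (* A negative power of [t] is absorbed by enlarging the outer exponent. *)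
  exists (i + k.+1)%N, j, q; split=> //.
  by rewrite NegzE -exprnN exprD -(mulrA (t ^+ i)) mulVKr ?unitrX.
have J_tr n l : J l -> J (l * t ^ n).
  move=> [i [j [q [Cl Iq]]]]; case: n => k.
    exists i, j, (q * Y ^+ k); split; last exact: IMr.
    rewrite -!mulrA -exprnP -exprD addnC exprD !mulrA.
    exact: poly_pair_Yr.
  exists i, (k.+1 + j)%N, q; split=> //.
  by rewrite NegzE -exprnN exprD !mulrA mulrVK ?unitrX.
have J_ideal : two_sided_ideal J.
  split=> // a b.
    move=> Jb; elim/laurent_ind: a => [|a1 a2 J1 J2|a n]; first by rewrite mul0r.
      by rewrite mulrDl; apply: JD.
    by rewrite -mulrA; apply/J_gl/J_tl.
  move=> Ja; elim/laurent_ind: b => [|b1 b2 J1 J2|b n]; first by rewrite mulr0.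
    by rewrite mulrDr; apply: JD.
  by rewrite mulrA; apply/J_tr/J_gr.
(* If J = 0, a non-zero q in I would give a non-zero l in J. If J = L, then 1 in J pairs t^(a+b)
   with an element of I, which must be Y^(a+b). *)
have [JE|JE] := L_ideals J J_ideal.
  case: In0; apply/seteqP; split=> [q Iq|_ ->] //=; apply: contrapT => q0.
  have [l [N [l0 Cl]]] := poly_pair_neq0 q0; case: l0.
  suff : J l by rewrite JE.
  by exists 0%N, 0%N, (q * Y ^+ N); rewrite mul1r mulr1; split=> //; apply: IMr.
have : J 1 by rewrite JE.
move=> [a [b [q [C1 Iq]]]]; exists (a + b)%N.
rewrite (_ : _ ^+ _ = q) //; apply: poly_pair_fun C1.
by have := PolyPairM 1 (a + b); rewrite !rmorph1 !mul1r mulr1 exprD.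
Qed.

End Localization.

(** * Uniqueness of the proper non-zero ideal *)

Lemma ideal_sub (Q : pzRingType) (I : set Q) a b :
  two_sided_ideal I -> I (a - b) -> I b -> I a.
Proof. by move=> [_ ID _ _] /ID Iab /Iab; rewrite subrK. Qed.

Lemma ideal1 (Q : pzRingType) (I : set Q) :
  two_sided_ideal I -> I 1 -> I = setT.
Proof.
by move=> [_ _ IM _] I1; apply/seteqP; split=> // a _; rewrite -(mulr1 a); apply: IM.
Qed.

Section ProperIdeals.
Variables (A Q : pzRingType) (sigma tau : A -> A) (w : A).
Variables (h : {rmorphism A -> Q}) (X Y : Q) (p : nat).
Hypothesis G : gwa sigma tau w h X Y.
Hypothesis Q_span : graded_span h X Y.
Local Notation wk k := (iter k sigma w).
Hypothesis w_central : forall k a, GRing.comm (wk k) a.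
Let M := set_sum (right_multiples w) (right_multiples (wk p.+1)).
Hypothesis M_maximal : maximal_ideal M.
Hypothesis comaximal : forall n, (1 <= n)%N -> n <> p.+1 ->
  set_sum (right_multiples w) (right_multiples (wk n)) = setT.
Hypothesis powers : forall I : set Q, two_sided_ideal I -> I <> [set 0] ->
  (exists d, I (Y ^+ d)) /\ (exists d, I (X ^+ d)).

Definition proper_ideal (I : set Q) :=
  [/\ two_sided_ideal I, I <> [set 0] & ~ I 1].

Let e := Y ^+ p * X ^+ p.

(** The scalar is the product of sigma^i(w) for 1 <= i <= k. As p = m - 1, for k <= p each factor is
    comaximal with [w], hence so is the product. *)
Lemma YXn k : exists2 s, Y ^+ k * X ^+ k = h s &
  (forall a, GRing.comm s a) /\
  ((k <= p)%N -> exists a b, 1 = w * a + s * b).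
Proof.
elim: k => [|k [s YX [sC sco]]].
  exists 1; first by rewrite rmorph1 mulr1.
  split=> [a|_]; first by rewrite /GRing.comm mul1r mulr1.
  by exists 0, 1; rewrite mulr0 add0r mulr1.
exists (s * wk k.+1).
  rewrite exprSr exprS mulrA -(mulrA _ Y X) (gwaYX G) (gwaYn G) -mulrA YX.
  by rewrite -rmorphM -iterSr w_central.
split=> [a|lkp].
  by apply/commr_sym/commrM; apply/commr_sym; [apply: sC|apply: w_central].
have [a [b e1]] := sco (ltnW lkp).
have : setT (1 : A) by [].
rewrite -(comaximal (n := k.+1)) //; last by move=> [kp]; rewrite kp ltnn in lkp.
case=> _ [a' _ <-] [_ [b' _ <-] e2].
exists (a + a' * (s * b)), (b' * b).
have e3 : s * b = w * (a' * (s * b)) + s * wk k.+1 * (b' * b).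
  rewrite -{1}[s * b]mul1r -e2 mulrDl -mulrA; congr (_ + _).
  by rewrite mulrA -(sC (wk k.+1 * b')) !mulrA.
by rewrite mulrDr -addrA -e3.
Qed.

(** Write 1 = w a + sigma^(k+1)(w) b and use w Y^k = X Y^(k+1) and sigma^(k+1)(w) Y^k = Y^(k+1)
    X. *)
Lemma Y_down I k : proper_ideal I -> k <> p -> I (Y ^+ k.+1) -> I (Y ^+ k).
Proof.
move=> [[_ ID IMl IMr] _ _] kp IY; have : setT (1 : A) by [].
rewrite -(comaximal (n := k.+1)) //; last by case.
case=> _ [a _ <-] [_ [b _ <-] e1].
rewrite -[Y ^+ k]mul1r -(rmorph1 h) -e1 rmorphD mulrDl; apply/ID.
  rewrite (w_central 0 a : w * a = _) rmorphM -mulrA; apply/IMl.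
  by rewrite -(gwaXY G) -mulrA -exprS; apply/IMl.
rewrite (w_central k.+1 b) rmorphM -mulrA; apply/IMl.
by rewrite iterSr -(gwaYn G) -(gwaYX G) mulrA -exprSr; apply/IMr.
Qed.

(** Mirror computation: X^k w = X^(k+1) Y and X^k sigma^(k+1)(w) = Y X^(k+1). *)
Lemma X_down I k : proper_ideal I -> k <> p -> I (X ^+ k.+1) -> I (X ^+ k).
Proof.
move=> [[_ ID IMl IMr] _ _] kp IX; have : setT (1 : A) by [].
rewrite -(comaximal (n := k.+1)) //; last by case.
case=> _ [a _ <-] [_ [b _ <-] e1].
rewrite -[X ^+ k]mulr1 -(rmorph1 h) -e1 rmorphD mulrDr; apply/ID.
  rewrite rmorphM mulrA; apply/IMr.
  by rewrite -(gwaXY G) mulrA -exprSr; apply/IMr.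
rewrite rmorphM mulrA; apply/IMr.
rewrite (gwaXn G) iterSr.
have -> : iter k tau (iter k sigma (sigma w)) = sigma w.
  by elim: k {kp IX b e1} (sigma w) => // k IH c; rewrite iterSr iterS (gwaK G).
by rewrite -(gwaYX G) -mulrA -exprS; apply/IMl.
Qed.

(** From an exponent at most [p] the descent is never blocked and would reach Z^0 = 1. *)
Lemma low_power_notin (Z : Q) I : proper_ideal I ->
  (forall k, k <> p -> I (Z ^+ k.+1) -> I (Z ^+ k)) ->
  forall k, (k <= p)%N -> ~ I (Z ^+ k).
Proof.
move=> [_ _ nI1] down; elim=> [|k IH] kp; first by rewrite expr0.
move=> /down IZ; apply: (IH (ltnW kp)); apply: IZ => kpE.
by rewrite kpE ltnn in kp.
Qed.

Lemma high_power_in (Z : Q) I : proper_ideal I ->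
  (forall k, k <> p -> I (Z ^+ k.+1) -> I (Z ^+ k)) ->
  (exists d, I (Z ^+ d)) -> I (Z ^+ p.+1).
Proof.
move=> PI down [d Id].
have [dp|pd] := leqP d p; first by case: (low_power_notin PI down dp).
elim: d pd Id => // d IH; rewrite ltnS leq_eqVlt => /orP [/eqP -> //|pd].
move=> /down Id; apply: IH => //; apply: Id => dp.
by rewrite dp ltnn in pd.
Qed.

Lemma Yp_in I : proper_ideal I -> I (Y ^+ p.+1).
Proof.
move=> PI; apply: (high_power_in PI) => [k|]; first exact: Y_down.
by case: PI => I1 I2 _; case: (powers I1 I2).
Qed.

Lemma Xp_in I : proper_ideal I -> I (X ^+ p.+1).
Proof.
move=> PI; apply: (high_power_in PI) => [k|]; first exact: X_down.
by case: PI => I1 I2 _; case: (powers I1 I2).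
Qed.

(** The generators of [M] carry [e] into I: w e = X Y^(p+1) X^p and sigma^(p+1)(w) e = Y^(p+1)
    X^(p+1). *)
Lemma Me_in I a : proper_ideal I -> M a -> I (h a * e).
Proof.
move=> PI; have := Yp_in PI; case: PI => [[_ ID IMl IMr] _ _] IY.
case=> _ [b _ <-] [_ [c _ <-] <-]; rewrite rmorphD mulrDl; apply/ID.
  rewrite (w_central 0 b : w * b = _) rmorphM -mulrA; apply/IMl.
  by rewrite -(gwaXY G) /e !mulrA -(mulrA X) -exprS; apply/IMr/IMl.
rewrite (w_central p.+1 c) rmorphM -mulrA; apply/IMl.
rewrite iterSr /e mulrA -(gwaYn G) -(gwaYX G) mulrA -exprSr.
by apply/IMr/IMr.
Qed.

(* e is a scalar multiple of a corner idempotent of Q modulo any proper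
   non-zero ideal, and the corner itself is A/M. *)
Lemma corner r :
  exists c, forall I, proper_ideal I -> I (e * r * e - h c * (e * e)).
Proof.
(* The scalar [c] is built from the degree 0 terms of [r], independently of I, so that two ideals
   can share it. In other degrees a factor Y^(p+1) or X^(p+1) appears. *)
have [s es [sC _]] := YXn p.
elim/(graded_ind Q_span): r => [|a b [c cP] [d dP]|a n].
- exists 0 => I [[I0 _ _ _] _ _].
  by rewrite mulr0 rmorph0 !mul0r subr0.
- exists (c + d) => I PI; rewrite mulrDr mulrDl rmorphD mulrDl opprD addrACA.
  by have [[_ ID _ _] _ _] := PI; apply/ID; [apply: cP|apply: dP].
have eC : e * h a = h a * e by rewrite /e es -!rmorphM sC.
case: n => [[|k]|k] /=.
- exists a => I [[I0 _ _ _] _ _]; rewrite expr0 mulr1 eC.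
  by rewrite mulrA subrr.
- exists 0 => I PI; rewrite rmorph0 mul0r subr0 mulrA eC.
  have := Yp_in PI; case: PI => [[_ ID IMl IMr] _ _] IY.
  rewrite -mulrA; apply/IMl.
  by rewrite /e mulrA -exprD addSnnS exprD; apply/IMr/IMl.
exists 0 => I PI; rewrite rmorph0 mul0r subr0 mulrA eC.
have := Xp_in PI; case: PI => [[_ ID IMl IMr] _ _] IX.
apply/IMr; rewrite /e -!mulrA -exprD addnS -addSn exprD.
by do 2!apply/IMl; apply/IMr.
Qed.

(** [e] is the image of a scalar s with 1 = w a + s b. As w Y^p = X Y^(p+1) is in I, having [e] in I
    would put Y^p in I. *)
Lemma e_notin I : proper_ideal I -> ~ I e.
Proof.
move=> PI Ie; have [s es [sC sco]] := YXn p; have [a [b e1]] := sco (leqnn p).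
apply: (low_power_notin (Z := Y) PI _ (leqnn p)) => [k|].
  exact: Y_down.
have := Yp_in PI; case: PI => [[_ ID IMl IMr] _ _] IY.
rewrite -[Y ^+ p]mul1r -(rmorph1 h) e1 rmorphD mulrDl; apply/ID.
  rewrite (w_central 0 a : w * a = _) rmorphM -mulrA; apply/IMl.
  by rewrite -(gwaXY G) -mulrA -exprS; apply/IMl.
by rewrite rmorphM -es; do 2!apply/IMr.
Qed.

(** The c with c e^2 in I form an ideal of [A] containing [M], so it is [M] or [A]; in the latter
    case e^2, and then [e], would lie in I. *)
Lemma corner_in I c : proper_ideal I -> I (h c * (e * e)) -> M c.
Proof.
move=> PI Ic; apply: contrapT => nMc; have [s es [sC sco]] := YXn p.
have [a [b e1]] := sco (leqnn p); case: (e_notin PI).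
have eC q : e * h q = h q * e by rewrite /e es -!rmorphM sC.
have eeC q : e * e * h q = h q * (e * e) by rewrite -mulrA eC mulrA eC -mulrA.
have [[I0 ID IMl IMr] _ _] := PI.
pose N : set A := [set q | I (h q * (e * e))].
have [_ _ Mmax] := M_maximal.
have NI : two_sided_ideal N.
  split=> [|q r Nq Nr|q r Nr|q r Nq]; rewrite /N /=.
  - by rewrite rmorph0 mul0r.
  - by rewrite rmorphD mulrDl; apply/ID.
  - by rewrite rmorphM -mulrA; apply/IMl.
  - by rewrite rmorphM -mulrA -eeC mulrA; apply/IMr.
have MN : M `<=` N by move=> q Mq; rewrite /N /= mulrA; apply/IMr; apply: Me_in.
have [NM|NT] := Mmax N NI MN; first by case: nMc; rewrite -NM.
have : N 1 by rewrite NT.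
rewrite /N /= rmorph1 mul1r => Iee.
rewrite -[e]mul1r -(rmorph1 h) e1 rmorphD mulrDl; apply/ID.
  apply: Me_in => //; exists (w * a); first by exists a.
  by exists 0; rewrite ?addr0 //; exists 0; rewrite ?mulr0.
by rewrite rmorphM -es -mulrA -eC mulrA; apply/IMr.
Qed.

(** Were J proper, it would be a proper non-zero ideal containing [e]. So [e] generates the unit
    ideal modulo I. *)
Lemma full_corner I (J : set Q) : proper_ideal I ->
  two_sided_ideal J -> I `<=` J -> J e -> J 1.
Proof.
move=> [II In0 nI1] JI IJ Je; apply: contrapT => nJ1.
apply: (@e_notin J) => //; split=> // J0; apply: In0.
apply/seteqP; split=> [q /IJ|_ ->]; first by rewrite J0.
by case: II.
Qed.

(* Both ideals are recovered from the corner: r is in I if and only if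
   e a r b e is in I for all a and b. *)
Lemma proper_ideal_le I J : proper_ideal I -> proper_ideal J -> I `<=` J.
Proof.
move=> PI PJ r Ir; have [[I0 ID IMl IMr] _ _] := PI.
have [JJ _ _] := PJ; have [J0 JD JMl JMr] := JJ.
(* One [c] describes e a r b e modulo both ideals: [r] in I puts [c] in [M], and then c e^2 lies in
   J. *)
have He a b : J (e * (a * r * b) * e).
  have [c cP] := corner (a * r * b).
  apply: (ideal_sub JJ (cP J PJ)); rewrite mulrA; apply/JMr; apply: Me_in => //.
  have [II _ _] := PI; apply: (corner_in PI).
  apply: (ideal_sub II (b := e * (a * r * b) * e)).
    by rewrite -opprB -mulN1r; apply/IMl; apply: cP.
  by apply/IMr/IMl/IMr/IMl.
(* The elements that may replace the left-hand [e] form an ideal containing J and [e], hence 1; [J2]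
   then removes the right-hand [e]. *)
pose J1 : set Q := [set q | forall a b, J (q * (a * r * b) * e)].
have J1_1 : J1 1.
  apply: (full_corner (J := J1) PJ) => [|q Jq a b|];
    [|by apply/JMr/JMr|exact: He].
  split=> [|q q' H H'|q q' H|q q' H] a b; rewrite ?mul0r //.
  - by rewrite !mulrDl; apply/JD.
  - by move: (H a b); rewrite -!mulrA; apply: JMl.
  - by move: (H (q' * a) b); rewrite -!mulrA.
pose J2 : set Q := [set q | forall b, J (r * b * q)].
have : J2 1.
  apply: (full_corner (J := J2) PJ) => [|q Jq b|b];
    last by have := J1_1 1 b; rewrite !mul1r.
    split=> [|q q' H H'|q q' H|q q' H] b; rewrite ?mulr0 //.
    - by rewrite !mulrDr; apply/JD.
    - by move: (H (b * q)); rewrite -!mulrA.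
    - by rewrite mulrA; apply/JMr.
  exact: JMl.
by move/(_ 1); rewrite !mulr1.
Qed.

End ProperIdeals.

(** * Existence of a proper non-zero ideal *)

Section ExistsProperIdeal.
Variables (A Q : pzRingType) (sigma tau : A -> A) (w : A).
Variables (h : {rmorphism A -> Q}) (X Y : Q) (p : nat).
Hypothesis G : gwa sigma tau w h X Y.
Hypothesis Q_span : graded_span h X Y.
Hypothesis A_domain : is_domain A.
Hypothesis w_neq0 : w <> 0.
Variable rho : Q -> A.
Hypothesis rhoD : forall a b, rho (a + b) = rho a + rho b.
Hypothesis rho_gen : forall a n,
  rho (h a * graded_gen X Y n) = if n == 0 then a else 0.
Variable M : set A.
Hypothesis M_ideal : two_sided_ideal M.
Hypothesis M_proper : ~ M 1.
Hypothesis wM : M w.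
Hypothesis wpM : M (iter p.+1 sigma w).

Lemma graded_functional_h a : rho (h a) = a.
Proof. by have := rho_gen a 0; rewrite mulr1. Qed.

(** Only total degree 0 counts. If a has degree j >= 0, then Y^j b is a scalar times X^(p+1), and
    the inner Y X, moved left past Y^p, yields sigma^(p+1)(w). If a has negative degree, an [X]
    meets a remaining [Y] and yields [w]. *)
Lemma graded_functional_sandwich a b : M (rho (a * Y ^+ p.+1 * b)).
Proof.
have rho0 : rho 0 = 0 by apply: (addrI (rho 0)); rewrite -rhoD !addr0.
have [M0 MD MMl MMr] := M_ideal.
elim/(graded_ind Q_span): a => [|a1 a2 IH1 IH2|a k].
- by rewrite !mul0r rho0.
- by rewrite !mulrDl rhoD; apply: MD.
elim/(graded_ind Q_span): b => [|b1 b2 IH1 IH2|b l].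
- by rewrite mulr0 rho0.
- by rewrite mulrDr rhoD; apply: MD.
have gen n : gdeg h X Y n (graded_gen X Y n) by exists 1; rewrite rmorph1 mul1r.
have graded_genX j : gdeg h X Y (- Posz j) (X ^+ j).
  by have := gen (- Posz j); rewrite -graded_genN.
have hgen c n : gdeg h X Y n (h c * graded_gen X Y n) by exists c.
have [eq0|neq0] := eqVneq (k + Posz p.+1 + l) 0; last first.
  have [c ->] := gdeg_mul G (gdeg_mul G (hgen a k) (gen (Posz p.+1))) (hgen b l).
  by rewrite rho_gen (negPf neq0).
case: k eq0 => j eq0 /=.
  have [c] := gdeg_mul G (gen (Posz j)) (hgen b l).
  have -> : Posz j + l = Negz p.
    by apply/eqP; rewrite NegzE -addr_eq0 -eq0 addrAC.
  move=> /= jl; rewrite -(mulrA (h a)) -exprD addnC exprD -!mulrA jl.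
  have [s] := gdeg_mul G (gen (Posz p)) (gen (- Posz p)).
  rewrite subrr -graded_genN /= expr0 mulr1 => YX.
  rewrite (mulrA (Y ^+ p.+1)) (gwaYn G) -!mulrA exprSr exprS -(mulrA _ Y).
  rewrite (mulrA Y X) (gwaYX G) (mulrA (Y ^+ p) (h _)) (gwaYn G) -!mulrA YX.
  by rewrite -iterSr -!rmorphM graded_functional_h; apply/MMl/MMl/MMr.
have [c] := gdeg_mul G (graded_genX j) (gdeg_mul G (gen (Posz p.+1)) (hgen b l)).
have -> : - Posz j + (Posz p.+1 + l) = 1.
  apply: (addIr (-1)); rewrite [RHS]subrr -eq0 NegzE -(addn1 j) (PoszD j) opprD.
  by rewrite addrAC -!addrA.
move=> /= jl; rewrite exprS -!mulrA [X ^+ j * _]jl (mulrA X) (gwaX G) -mulrA expr1.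
by rewrite (gwaXY G) -!rmorphM graded_functional_h; apply/MMl/MMl.
Qed.

Lemma exists_proper_ideal : exists I : set Q, proper_ideal I.
Proof.
have [M0 MD MMl MMr] := M_ideal.
have rho0 : rho 0 = 0 by apply: (addrI (rho 0)); rewrite -rhoD !addr0.
exists [set r | forall a b, M (rho (a * r * b))]; split.
- split=> [a b|q r Hq Hr a b|q r Hr a b|q r Hq a b] /=.
  + by rewrite mulr0 mul0r rho0.
  + by rewrite mulrDr mulrDl rhoD; apply: MD.
  + by rewrite mulrA; apply: Hr.
  + by rewrite mulrA -mulrA; apply: Hq.
(* Y^(p+1) is non-zero: Y^(p+1) X^(p+1) is the image of a non-zero scalar, and [rho] recovers
   scalars. *)
- move=> E; have Y0 : Y ^+ p.+1 = 0.
    have : [set r | forall a b, M (rho (a * r * b))] (Y ^+ p.+1).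
      exact: graded_functional_sandwich.
    by rewrite E.
  have sw0 : sigma w <> 0 by move=> /(congr1 tau); rewrite (gwaK G) -(gwa0 G) (gwaK G).
  have [c c0 YX] := gwa_XnYn (gwa_dual G) A_domain sw0 p.+1.
  by apply: c0; rewrite -(graded_functional_h c) -YX Y0 mul0r.
by move=> /(_ 1 1); rewrite !mulr1 -(rmorph1 h) graded_functional_h.
Qed.

End ExistsProperIdeal.

(** With t^-1 in place of [t], the comparison with the Laurent ring applies to powers of [X]. *)
Lemma laurent_basis_inv (A : pzRingType) (L : unitRingType)
    (g : {rmorphism A -> L}) (t : L) :
  left_basis g (fun n : int => t ^ n) -> left_basis g (fun n : int => t^-1 ^ n).
Proof.
move=> [sp free]; split=> [l|r c ur].
  have [r [c ->]] := sp l; exists [seq - i | i <- r], (fun i => c (- i)).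
  by rewrite big_map; apply: eq_bigr => i _; rewrite exprz_inv !opprK.
move=> E i ir; rewrite -[i]opprK.
apply: (free [seq - i | i <- r] (fun i => c (- i))); last 1 first.
- by rewrite map_f.
- by rewrite map_inj_uniq //; apply: oppr_inj.
rewrite big_map -[RHS]E; apply: eq_bigr => n _.
by rewrite exprz_inv !opprK.
Qed.

(** * Monomials in an ambiskew polynomial ring *)

Section Ambiskew.
Variables (K : fieldType) (A R : algType K) (alpha : {lrmorphism A -> A}).
Variables (v : A) (f : {lrmorphism A -> R}) (x y : R).
Hypothesis R_ambiskew : is_ambiskew_polynomial_ring alpha v f x y.

Lemma ambiskew_relations :
  [/\ forall a, y * f a = f (alpha a) * y,
      forall a, x * f (alpha a) = f a * x & x * y = y * x + f v].
Proof.
have [S [i [y0 [beta [delta [j H]]]]]] := R_ambiskew.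
case: H => [[_ _ yi] [bi by0] [di dy0] [_ _ xj] [fE ->]]; split=> [a|a|].
- by rewrite !fE -!rmorphM yi rmorph0 addr0.
- by rewrite !fE xj bi di rmorph0 addr0.
by rewrite xj by0 dy0 fE.
Qed.

Lemma ambiskew_ind (D : R -> Prop) :
  D 0 -> (forall a b, D a -> D b -> D (a + b)) ->
  (forall a k l, D (f a * y ^+ k * x ^+ l)) -> forall r, D r.
Proof.
move=> D0 DD Dm r.
have [S [i [y0 [beta [delta [j H]]]]]] := R_ambiskew.
case: H => [[_ [spS _] _] _ _ [_ [spR _] _] [fE yE]].
have [s [c ->]] := spR r; apply: big_ind => // l _.
have [s' [c' ->]] := spS (c l); rewrite rmorph_sum mulr_suml.
apply: big_ind => // k _.
by have := Dm (c' k) k l; rewrite fE yE -rmorphXn -rmorphM.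
Qed.

(** Freeness is used twice: over [A] for each fixed power of [x], then over the intermediate
    ring. *)
Lemma ambiskew_functional (V : zmodType) (phi : nat -> nat -> A -> V) :
  (forall k l a b, phi k l (a + b) = phi k l a + phi k l b) ->
  exists F : R -> V, (forall a b, F (a + b) = F a + F b) /\
    forall a k l, F (f a * y ^+ k * x ^+ l) = phi k l a.
Proof.
move=> phiD; have [S [i [y0 [beta [delta [j H]]]]]] := R_ambiskew.
case: H => [[_ bS _] _ _ [_ bR _] [fE yE]].
have /choice [psi psiP] : forall l, exists F : S -> V,
    (forall a b, F (a + b) = F a + F b) /\
    forall k a, F (i a * y0 ^+ k) = phi k l a.
  by move=> l; apply: (linear_extension bS (phi := fun k => phi k l)) => k.
have [|F [FD FE]] := linear_extension bR (phi := psi).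
  by move=> l; have [] := psiP l.
exists F; split=> // a k l.
by rewrite fE yE -rmorphXn -rmorphM FE; have [_ ->] := psiP l.
Qed.

End Ambiskew.

(** * The quotient by the shifted Casimir element *)

Section ConformalQuotient.
Variables (K : fieldType) (A R : algType K) (alpha : {lrmorphism A -> A}).
Variables (tau : A -> A) (u : A) (lambda : K).
Variables (f : {lrmorphism A -> R}) (x y : R).
Variables (Q : pzRingType) (pi : {rmorphism R -> Q}) (h : {rmorphism A -> Q}).
Hypothesis alphaK : cancel alpha tau.
Hypothesis alphaVK : cancel tau alpha.
Hypothesis u_central : ring_center A u.
Hypothesis R_ambiskew : is_ambiskew_polynomial_ring alpha (u - alpha u) f x y.
Hypothesis Q_quotient :
  is_quotient (right_multiples ((x * y - f u) - lambda%:A)) pi.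
Hypothesis hE : forall a, h a = pi (f a).

Let w := u + lambda%:A.
Let zl := (x * y - f u) - lambda%:A.

Lemma conformal_w_central k a : GRing.comm (iter k alpha w) a.
Proof.
elim: k a => [|k IH] a.
  apply: commr_sym; apply: commrD; first exact/commr_sym/u_central.
  by rewrite /GRing.comm -scalerAl -scalerAr mul1r mulr1.
by rewrite -[a]alphaVK /GRing.comm iterS -!rmorphM IH.
Qed.

Lemma lrmorph_addA (B : algType K) (F : {lrmorphism A -> B}) a (k : K) :
  F (a + k%:A) = F a + k%:A.
Proof. by rewrite rmorphD /= linearZ /= rmorph1. Qed.

Lemma casimir_xy : zl = x * y - f w.
Proof. by rewrite /zl /w lrmorph_addA opprD addrA. Qed.

Lemma casimir_yx : zl = y * x - f (alpha w).
Proof.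
have [_ _ xy] := ambiskew_relations R_ambiskew.
rewrite casimir_xy xy /w !lrmorph_addA rmorphB -addrA; congr (_ + _).
by rewrite !opprD addrACA addrA addrAC subrr add0r addrC.
Qed.

Lemma pi_casimir r : pi (zl * r) = 0.
Proof.
have [_ /seteqP [_ ker]] := Q_quotient.
by apply: (ker (zl * r)); exists r.
Qed.

Lemma conformal_gwa : gwa alpha tau w h (pi x) (pi y).
Proof.
have [ya xa _] := ambiskew_relations R_ambiskew.
split=> // [|a|a||]; first exact: rmorph0.
- by rewrite !hE -!rmorphM ya.
- by rewrite !hE -!rmorphM -xa alphaVK.
- apply/subr0_eq; rewrite hE -rmorphM -rmorphB -casimir_xy.
  by rewrite -[zl]mulr1 pi_casimir.
apply/subr0_eq; rewrite hE -rmorphM -rmorphB -casimir_yx.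
by rewrite -[zl]mulr1 pi_casimir.
Qed.

Lemma conformal_span : graded_span h (pi x) (pi y).
Proof.
move=> q; have [/(_ q) [r <-] _] := Q_quotient.
elim/(ambiskew_ind R_ambiskew): r => [|a b [l al] [l' bl]|a k l].
- by exists [::]; rewrite big_nil rmorph0.
- by exists (l ++ l'); rewrite big_cat rmorphD al bl.
have [c E] : gdeg h (pi x) (pi y) (Posz k - Posz l) (pi y ^+ k * pi x ^+ l).
  apply: (gdeg_mul conformal_gwa); first by exists 1; rewrite rmorph1 mul1r.
  by exists 1; rewrite rmorph1 mul1r -graded_genN.
exists [:: (Posz k - Posz l, a * c)]; rewrite big_seq1 /=.
by rewrite !rmorphM !rmorphXn -hE -mulrA E mulrA.
Qed.

(** The degree 0 coefficient is defined on the free monomials of [R] and descends because it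
    vanishes on the multiples of [zl]. *)
Lemma conformal_functional : exists rho : Q -> A,
  (forall a b, rho (a + b) = rho a + rho b) /\
  forall a n, rho (h a * graded_gen (pi x) (pi y) n) = if n == 0 then a else 0.
Proof.
have [ya xa xy] := ambiskew_relations R_ambiskew.
(* [s k] is the scalar that y^k x^k becomes modulo [zl]; monomials with k <> l have non-zero
   degree. *)
pose s := fix s k := if k is k'.+1 then iter k'.+1 alpha w * s k' else 1.
pose phi k l a : A := if k == l then a * s k else 0.
have phiD k l a b : phi k l (a + b) = phi k l a + phi k l b.
  by rewrite /phi; case: ifP; rewrite ?addr0 // mulrDl.
have [F [FD FE]] := ambiskew_functional R_ambiskew phiD.
have F0 : F 0 = 0 by apply: (addrI (F 0)); rewrite -FD !addr0.
have FN r : F (- r) = - F r by apply: (addrI (F r)); rewrite -FD !subrr.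
have yn k a : y ^+ k * f a = f (iter k alpha a) * y ^+ k.
  elim: k a => [|k IH] a; first by rewrite !expr0 mul1r mulr1.
  by rewrite exprS -mulrA IH mulrA ya -mulrA -exprS.
have zlf a : zl * f a = f a * zl.
  rewrite casimir_xy mulrBl mulrBr -!rmorphM -mulrA ya mulrA xa -mulrA.
  by have := conformal_w_central 0 a; rewrite /GRing.comm /= => ->.
have zly k : zl * y ^+ k = y ^+ k * zl.
  elim: k => [|k IH]; first by rewrite expr0 mul1r mulr1.
  rewrite exprS -mulrA -IH !mulrA; congr (_ * _).
  by rewrite {1}casimir_yx casimir_xy mulrBl mulrBr ya -mulrA.
have Fzl r : F (zl * r) = 0.
  elim/(ambiskew_ind R_ambiskew): r => [|a b Fa Fb|a k l].
  - by rewrite mulr0.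
  - by rewrite mulrDr FD Fa Fb addr0.
  (* The two resulting monomials cancel under [F] by the recursion defining [s]. *)
  have -> : zl * (f a * y ^+ k * x ^+ l) =
      f a * y ^+ k.+1 * x ^+ l.+1
      - f (a * iter k.+1 alpha w) * y ^+ k * x ^+ l.
    rewrite !mulrA zlf -(mulrA (f a)) zly casimir_yx !mulrBr mulrBl.
    rewrite yn rmorphM -iterSr; congr (_ - _); last by rewrite !mulrA.
    by rewrite exprSr exprS !mulrA.
  rewrite FD FN !FE /phi eqSS; case: ifP => _; last by rewrite subrr.
  by rewrite -mulrA subrr.
have /choice [sec secP] : forall q, exists r, pi r = q by case: Q_quotient.
have FP r r' : pi r = pi r' -> F r = F r'.
  move=> E; have [_ /seteqP [ker _]] := Q_quotient.
  have [|r'' _ rE] := ker (r - r'); first by rewrite /= rmorphB E subrr.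
  by apply/subr0_eq; rewrite -FN -FD -rE Fzl.
exists (F \o sec); split=> [a b|a n] /=.
  by rewrite -FD; apply: FP; rewrite rmorphD !secP.
have E k l : pi (f a * y ^+ k * x ^+ l) = h a * (pi y ^+ k * pi x ^+ l).
  by rewrite !rmorphM !rmorphXn hE mulrA.
case: n => k /=.
  transitivity (F (f a * y ^+ k * x ^+ 0)).
    by apply: FP; rewrite secP E expr0 mulr1.
  rewrite FE /phi -[Posz k == 0]/(k == 0%N).
  by case: k => //=; rewrite mulr1.
transitivity (F (f a * y ^+ 0 * x ^+ k.+1)); last by rewrite FE.
by apply: FP; rewrite secP E expr0 mul1r.
Qed.

End ConformalQuotient.

(** * The unique non-zero prime ideal *)

Theorem corollary3p14
  (K : closedFieldType) (A : algType K)
  (A_domain : is_domain A)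
  (alpha : {lrmorphism A -> A}) (alpha_bij : bijective alpha)
  (u : A) (u_central : ring_center A u) (u_nscalar : ~ range (in_alg A) u)
  (R : algType K) (f : {lrmorphism A -> R}) (x y : R)
  (R_ambiskew : is_ambiskew_polynomial_ring alpha (u - alpha u) f x y)
  (L : unitAlgType K) (g : {lrmorphism A -> L}) (t : L)
  (L_laurent : is_skew_laurent_ring alpha g t)
  (L_simple : simple_ring L)
  (L_center : ring_center L = range (in_alg L))
  (lambda : K) (m : nat) (m_ge1 : (1 <= m)%N)
  (m_proper : set_sum (right_multiples (u + lambda%:A))
                (right_multiples (iter m alpha (u + lambda%:A))) <> setT)
  (m_maximal : maximal_ideal (set_sum (right_multiples (u + lambda%:A))
                (right_multiples (iter m alpha (u + lambda%:A)))))
  (other_n : forall n : nat, (1 <= n)%N -> n <> m ->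
     set_sum (right_multiples (u + lambda%:A))
       (right_multiples (iter n alpha (u + lambda%:A))) = setT)
  (Q : pzRingType) (pi : {rmorphism R -> Q})
  (Q_quotient :
     is_quotient (right_multiples ((x * y - f u) - lambda%:A)) pi) :
  exists! P : set Q, prime_ideal P /\ P <> [set 0].
Proof.
have [tau alphaK alphaVK] := alpha_bij.
case: m m_ge1 m_proper m_maximal other_n => // p _ M_proper M_max comax.
pose h : {rmorphism A -> Q} := pi \o f.
have hE a : h a = pi (f a) by [].
set w := u + lambda%:A in M_proper M_max comax *.
have w0 : w <> 0.
  move=> w0; apply: u_nscalar; exists (- lambda) => //.
  by rewrite /= scaleNr; apply/esym/eqP; rewrite -addr_eq0; apply/eqP.
have aw0 : alpha w <> 0.
  by move=> aw0; apply: w0; rewrite -(alphaK w) aw0 -(rmorph0 alpha) alphaK rmorph0.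
have wC := conformal_w_central lambda alphaVK u_central.
have G := conformal_gwa alphaK alphaVK R_ambiskew Q_quotient hE.
have sp := conformal_span alphaK alphaVK R_ambiskew Q_quotient hE.
have [rho [rhoD rhoE]] :=
  conformal_functional alphaVK u_central R_ambiskew Q_quotient hE.
have [t_unit t_basis t_comm] := L_laurent.
have powers I : two_sided_ideal I -> I <> [set 0] ->
    (exists d, I (pi y ^+ d)) /\ (exists d, I (pi x ^+ d)).
  move=> II In0; split.
    exact: (ideal_has_power G sp t_unit t_basis t_comm A_domain w0 L_simple II).
  (* For powers of [x], exchange the roles of [x] and [y], replacing [t] by t^-1 and [alpha] by its
     inverse. *)
  have tV_unit : t^-1 \is a GRing.unit by rewrite unitrV.
  have tV_comm a : t^-1 * g a = g (tau a) * t^-1.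
    apply: (mulrI t_unit); rewrite mulVKr // mulrA t_comm alphaVK.
    by rewrite mulrK.
  exact: (ideal_has_power (gwa_dual G) (graded_span_dual sp) tV_unit
            (laurent_basis_inv t_basis) tV_comm A_domain aw0 L_simple II).
have le_proper := proper_ideal_le G sp wC M_max comax powers.
set M := set_sum _ _ in M_proper M_max.
have [M_ideal _ _] := M_max.
have M1 : ~ M 1 by move=> M1; apply/M_proper/ideal1.
have wM : M w.
  exists w; first by exists 1; rewrite ?mulr1.
  by exists 0; rewrite ?addr0 //; exists 0; rewrite ?mulr0.
have wpM : M (iter p.+1 alpha w).
  exists 0; first by exists 0; rewrite ?mulr0.
  by exists (iter p.+1 alpha w); rewrite ?add0r //; exists 1; rewrite ?mulr1.
have [P PP] := exists_proper_ideal G sp A_domain w0 rhoD rhoE M_ideal M1 wM wpM.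
have proper_eq I : proper_ideal I -> I = P.
  by move=> PI; apply/seteqP; split; apply: le_proper.
have [PI Pn0 nP1] := PP.
exists P; split; last first.
  move=> P' [[P'I P'T _] P'n0]; apply/esym/proper_eq; split=> // P'1.
  by apply/P'T/ideal1.
split=> //; split=> // [PT|I J II JI IJP]; first by apply: nP1; rewrite PT.
(* A two-sided ideal lies in [P] or contains 1; two ideals outside [P] thus have 1 in their product,
   which makes [P] prime. *)
have dich I' : two_sided_ideal I' -> I' `<=` P \/ I' 1.
  move=> I'I; have [->|n0] := pselect (I' = [set 0]).
    by left=> _ ->; case: PI.
  have [I'1|nI'1] := pselect (I' 1); first by right.
  by left; rewrite (proper_eq I').
have [|I1] := dich I II; first by left.
have [|J1] := dich J JI; first by right.
case: nP1; apply: IJP; exists [:: (1, 1)]; split.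
  by move=> q; rewrite inE => /eqP ->.
by rewrite big_seq1 mulr1.
Qed.
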